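(* For every integer $n\ge 2^{2^6}$ there is an unweighted connected graph $G$ with $n$ nodes such that, if $T$ is an inverse leverage score weighted random spanning tree of $G$, then with probability at least $1-e^{-n^{0.4}}$, $$L_T\not\prec \frac{\log n}{8\log\log n}\cdot L_G .$$
   Context: Logarithms are base $2$. Let $G=(V,E)$ be a connected unweighted undirected graph (all edge weights equal $1$). For an edge $e=(u,v)$ let $b_e\in\mathbb{R}^V$ have entry $1$ at $u$, $-1$ at $v$, and $0$ elsewhere. The Laplacian is $L_G=\sum_{e\in E} b_eb_e^\top$, and $L_G^\dagger$ is its Moore-Penrose pseudoinverse. The leverage score of $e$ is $l_e=b_e^\top L_G^\dagger b_e$. An inverse leverage score weighted random spanning tree $T$ is a uniformly random spanning tree of $G$ in which each edge $e\in T$ is given weight $1/l_e$; its Laplacian is $L_T=\sum_{e\in T}\frac{1}{l_e}b_eb_e^\top$. For Laplacians $A,B$ on the vertex set $V$, $A\prec B$ means $x^\top A x<x^\top Bx$ for every nonzero $x\in\mathbb{R}^V$ orthogonal to the all-ones vector; $A\not\prec B$ is the negation, i.e. there is a nonzero $x$ orthogonal to the all-ones vector with $x^\top Ax\ge x^\top Bx$. *)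

(* Defs.v *)
From HB Require Import structures.
From mathcomp Require Import all_boot all_order all_algebra.
From mathcomp Require Import all_classical all_reals all_analysis.

Set Implicit Arguments.
Unset Strict Implicit.
Unset Printing Implicit Defensive.

Import Order.TTheory GRing.Theory Num.Theory.
Local Open Scope ring_scope.

Record sgraph (n : nat) := SGraph {
  adj :> rel 'I_n;
  adj_sym : symmetric adj;
  adj_irrefl : irreflexive adj }.

(* An undirected edge {u, v} is represented once, by the pair (u, v) with     *)
(* u < v.  This fixes the sign of the edge vector b_e, which is immaterial:   *)
(* Laplacians and leverage scores are even in b_e.                            *)
Definition edges n (G : sgraph n) : {set 'I_n * 'I_n} :=
  [set e : 'I_n * 'I_n | (e.1 < e.2)%N && G e.1 e.2].

Definition edge_rel n (S : {set 'I_n * 'I_n}) : rel 'I_n :=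
  fun u v => ((u, v) \in S) || ((v, u) \in S).

Definition rel_connected n (r : rel 'I_n) : Prop := forall u v, connect r u v.

Definition rel_acyclic n (r : rel 'I_n) : Prop :=
  forall s : seq 'I_n, (2 < size s)%N -> ~ ucycle r s.

Definition spanning_tree n (G : sgraph n) (T : {set 'I_n * 'I_n}) : Prop :=
  [/\ T \subset edges G, rel_connected (edge_rel T) & rel_acyclic (edge_rel T)].

Definition spanning_trees n (G : sgraph n) : {set {set 'I_n * 'I_n}} :=
  [set T : {set 'I_n * 'I_n} | `[< spanning_tree G T >]].

Section LinearAlgebra.
Variable R : realType.

(* The four Penrose equations; see moore_penrose_uniq, moore_penrose_ex.      *)
Definition moore_penrose m n (A : 'M[R]_(m, n)) (X : 'M[R]_(n, m)) : Prop :=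
  [/\ A *m X *m A = A, X *m A *m X = X,
      (A *m X)^T = A *m X & (X *m A)^T = X *m A].

Definition pinv m n (A : 'M[R]_(m, n)) : 'M[R]_(n, m) :=
  xget 0 [set X | moore_penrose A X]%classic.

Definition qform n (A : 'M[R]_n) (x : 'cV[R]_n) : R := (x^T *m A *m x) 0 0.

Lemma moore_penrose_uniq m n (A : 'M[R]_(m, n)) X Y :
  moore_penrose A X -> moore_penrose A Y -> X = Y.
Proof.
move=> [AXA XAX sAX sXA] [AYA YAY sAY sYA].
have E1 : A *m X = A *m Y.
  rewrite -sAX -{1}AYA -(mulmxA (A *m Y)) trmx_mul sAX sAY.
  by rewrite mulmxA AXA.
have E2 : X *m A = Y *m A.
  rewrite -sXA -{1}AYA -mulmxA mulmxA trmx_mul sYA sXA.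
  by rewrite -mulmxA (mulmxA A) AXA.
by rewrite -XAX E2 -mulmxA E1 mulmxA YAY.
Qed.

Lemma gram_unitmx m n (A : 'M[R]_(m, n)) : row_free A -> A *m A^T \in unitmx.
Proof.
move=> fA; rewrite -row_free_unit -kermx_eq0; apply/eqP/row_matrixP => i.
rewrite row0; set v := row i _.
have vA : v *m (A *m A^T) = 0 by apply/sub_kermxP; exact: row_sub.
have : ((v *m A) *m (v *m A)^T) 0 0 = 0.
  by rewrite trmx_mul mulmxA -(mulmxA v) vA mul0mx mxE.
rewrite mxE => /eqP; rewrite psumr_eq0; last first.
  by move=> j _; rewrite [_^T _ _]mxE -expr2 sqr_ge0.
move=> /allP h; have vA0 : v *m A = 0.
  apply/rowP => j; have := h j (mem_index_enum j).
  by rewrite [_^T _ _]mxE -expr2 sqrf_eq0 /= [in RHS]mxE => /eqP.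
by apply: (row_free_inj fA); rewrite vA0 mul0mx.
Qed.

Lemma moore_penrose_ex m n (A : 'M[R]_(m, n)) : exists X, moore_penrose A X.
Proof.
suff gen r (C : 'M[R]_(m, r)) (D : 'M[R]_(r, n)) :
    row_full C -> row_free D -> exists X, moore_penrose (C *m D) X.
  have := gen _ _ _ (col_base_full A) (row_base_free A).
  by rewrite mulmx_base.
move=> fC fD.
have uD : D *m D^T \in unitmx by exact: gram_unitmx.
have uC : C^T *m C \in unitmx.
  rewrite -{2}(trmxK C); apply: gram_unitmx.
  by rewrite /row_free mxrank_tr; exact: fC.
pose U := invmx (D *m D^T); pose W := invmx (C^T *m C).
have sU : U^T = U by rewrite /U trmx_inv trmx_mul trmxK.
have sW : W^T = W by rewrite /W trmx_inv trmx_mul trmxK.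
have AX : C *m D *m (D^T *m U *m (W *m C^T)) = C *m W *m C^T.
  have -> : C *m D *m (D^T *m U *m (W *m C^T))
          = C *m ((D *m D^T) *m U) *m W *m C^T by rewrite !mulmxA.
  by rewrite mulmxV // mulmx1.
have XA : D^T *m U *m (W *m C^T) *m (C *m D) = D^T *m U *m D.
  have -> : D^T *m U *m (W *m C^T) *m (C *m D)
          = D^T *m U *m (W *m (C^T *m C)) *m D by rewrite !mulmxA.
  by rewrite mulVmx // mulmx1.
exists (D^T *m U *m (W *m C^T)); split; rewrite ?AX ?XA.
- have -> : C *m W *m C^T *m (C *m D) = C *m (W *m (C^T *m C)) *m D.
    by rewrite !mulmxA.
  by rewrite mulVmx // mulmx1.
- have -> : D^T *m U *m D *m (D^T *m U *m (W *m C^T))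
          = D^T *m U *m ((D *m D^T) *m U) *m (W *m C^T) by rewrite !mulmxA.
  by rewrite mulmxV // mulmx1.
- by rewrite !trmx_mul trmxK sW mulmxA.
- by rewrite !trmx_mul trmxK sU mulmxA.
Qed.

Lemma pinvP m n (A : 'M[R]_(m, n)) : moore_penrose A (pinv A).
Proof.
exact: (xgetPex _ (moore_penrose_ex A)).
Qed.

End LinearAlgebra.

Section Laplacians.
Variable R : realType.

Definition edge_vec n (e : 'I_n * 'I_n) : 'cV[R]_n :=
  delta_mx e.1 0 - delta_mx e.2 0.

Definition laplacian n (w : 'I_n * 'I_n -> R) (S : {set 'I_n * 'I_n}) :
    'M[R]_n :=
  \sum_(e in S) w e *: (edge_vec e *m (edge_vec e)^T).

Definition graph_laplacian n (G : sgraph n) : 'M[R]_n :=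
  laplacian (fun=> 1) (edges G).

Definition leverage n (G : sgraph n) (e : 'I_n * 'I_n) : R :=
  qform (pinv (graph_laplacian G)) (edge_vec e).

Definition inv_leverage_laplacian n (G : sgraph n) (T : {set 'I_n * 'I_n}) :
    'M[R]_n :=
  laplacian (fun e => (leverage G e)^-1) T.

Definition lap_lt n (A B : 'M[R]_n) : Prop :=
  forall x : 'cV[R]_n, x != 0 -> \sum_i x i 0 = 0 -> qform A x < qform B x.

(* Probability of the event P for a uniformly random spanning tree of G.      *)
Definition ust_prob n (G : sgraph n) (P : {set 'I_n * 'I_n} -> Prop) : R :=
  #|[set T in spanning_trees G | `[< P T >]]|%:R / #|spanning_trees G|%:R.

Definition log2 (x : R) : R := ln x / ln 2.

End Laplacians.

(* Main.v *)
Require Import Defs.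
From mathcomp Require Import all_boot all_order all_algebra.
From mathcomp Require Import all_classical all_reals all_analysis.
From mathcomp Require Import ring lra.

Import Order.TTheory GRing.Theory Num.Theory.
Local Open Scope ring_scope.

Set Implicit Arguments.
Unset Strict Implicit.

(* G is a windmill: cliques on m vertices sharing one hub vertex, where m is  *)
(* about log n / (4 log log n).  Fix a vertex c, not the hub, in each clique. *)
(* All edges at c have leverage 2/m, so if a tree T contains all of them then *)
(* the cut of c alone has weight at least m/2 times larger in L_T than in     *)
(* L_G.  Replacing the part of a spanning tree in one clique by the star at c *)
(* gives a spanning tree again, and the old part is determined by its parent  *)
(* map towards the hub.  Hence each clique carries this star with conditional *)
(* probability at least m^-(m-1), whatever happens in the others; m^m is at   *)
(* most n^0.6, and there are about n/m cliques.                               *)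

(** Two facts meet. Spectrally, a clique on m vertices hangs on the rest of the graph at the hub
    alone, so an edge at [c] has leverage 2/m, as in a complete graph ([star_leverage]). When T
    contains the star at [c], the centred indicator of [c] therefore defeats the strict inequality
    ([star_not_lap_lt]). Combinatorially, an injection replaces independence: a tree is recovered
    from its starred version ([starify_tree]) and one of M = m^(m-1) parent maps
    ([tree_block_code]). So in any family of trees stable under the replacement, at least one in M
    contains the star ([starify_count]). Trees missing all earlier stars form such a family, and
    induction ([no_star_count]) bounds the share of trees missing all k stars by (1 - 1/M)^k <=
    e^(-k/M). [blade_size] picks m with m/2 above the required factor and k/M >= n^0.4. *)

(** Used to keep vertices with a single available neighbour off cycles. *)
Lemma ucycle_nbrs (T : eqType) (r : rel T) (s : seq T) x :
  ucycle r s -> (2 < size s)%N -> x \in s ->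
  exists y z, [/\ y \in s, z \in s, y != z, r x y & r z x].
Proof.
move=> /andP[cs us] ss xs; case: (rot_to xs) => i p rotp.
have smem y : (y \in s) = (y \in x :: p) by rewrite -rotp mem_rot.
move: cs us ss; rewrite -(rot_cycle i) -(rot_uniq i) -(size_rot i s) rotp.
case: p rotp smem => [|y [|z p]] //= _ smem; rewrite rcons_path.
move=> /and4P[rxy _ _ rzx] /and4P[_ yzp _ _] _.
exists y, (last z p); split => //.
- by rewrite smem !inE eqxx orbT.
- by rewrite smem !inE -in_cons mem_last !orbT.
- by apply: contraNneq yzp => ->; apply: mem_last.
Qed.

(** A simple path avoiding the edge has at least two steps, and the edge closes it into a cycle. *)
Lemma acyclic_bridge n (r : rel 'I_n) u v :
  rel_acyclic r -> u != v -> r v u ->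
  ~ connect [rel x y | r x y && ((x, y) \notin [:: (u, v); (v, u)])] u v.
Proof.
move=> acr uv rvu /connectP[p0 pth]; case/shortenP: pth.
move=> [|w [|w' p]] /=.
- by move=> _ _ _ /eqP; rewrite eq_sym (negPf uv).
- by move=> + _ _ vw; rewrite -vw !inE eqxx /= andbF.
move=> /and3P[/andP[ruw _] /andP[rww _]] pth us _ lastv.
apply: (acr [:: u, w, w' & p]) => //; apply/andP; split => //=.
rewrite ruw rww rcons_path -lastv rvu andbT.
by apply: sub_path pth => x y /andP[].
Qed.

(** [d] is the distance to [h], and [f] steps along a shortest path; the decrease of [d] allows
    induction towards [h]. *)
Lemma parent_map (T : finType) (r : rel T) h :
  (forall x, connect r x h) ->
  exists (f : T -> T) (d : T -> nat),
    forall x, x != h -> r x (f x) /\ (d (f x) < d x)%N.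
Proof.
move=> rh; pose P x k := [exists p : k.-tuple T, path r x p && (last x p == h)].
have exP x : exists k, P x k.
  have /connectP[p pth lasth] := rh x.
  exists (size p); apply/existsP; exists (in_tuple p).
  by rewrite pth -lasth eqxx.
pose d x := ex_minn (exP x).
have /choice[f fP] : forall x, exists y, x != h -> r x y /\ (d y < d x)%N.
  move=> x; rewrite [d x]/d; case: ex_minnP => k /existsP[[p /= /eqP sp]].
  case: p sp => [|y p] /= sp.
    by move=> -> _; exists x.
  move=> /andP[/andP[rxy pth] /eqP ph] _; exists y => _; split=> //.
  rewrite -sp /d; case: ex_minnP => k' _; apply.
  by apply/existsP; exists (in_tuple p); rewrite pth ph eqxx.
by exists f, d.
Qed.

(** * Spanning trees, and replacing their part in one clique by a star *)

Section Graph.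
Variables (n : nat) (G : sgraph n).
Implicit Types (T : {set 'I_n * 'I_n}) (A B : {set 'I_n}).

Definition edges_at A : {set 'I_n * 'I_n} :=
  [set e in edges G | (e.1 \in A) || (e.2 \in A)].

Lemma edge_rel_sym T : symmetric (edge_rel T).
Proof. by move=> x y; rewrite /edge_rel orbC. Qed.

Lemma edge_rel_edges u v : edge_rel (edges G) u v = G u v.
Proof.
rewrite /edge_rel !inE /= [G v u]adj_sym.
by case: ltngtP => [_|_|/val_inj->] /=; rewrite ?orbF ?adj_irrefl.
Qed.

Lemma edge_rel_at A u v :
  edge_rel (edges_at A) u v = G u v && ((u \in A) || (v \in A)).
Proof.
rewrite -edge_rel_edges /edge_rel !inE /= [(v \in A) || _]orbC.
by rewrite -andb_orl.
Qed.

Lemma edge_relU T1 T2 u v :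
  edge_rel (T1 :|: T2) u v = edge_rel T1 u v || edge_rel T2 u v.
Proof. by rewrite /edge_rel !inE orbACA. Qed.

Lemma edge_rel_sub T1 T2 : T1 \subset T2 -> subrel (edge_rel T1) (edge_rel T2).
Proof.
move=> /fintype.subsetP s x y.
by move=> /orP[/s|/s]; rewrite /edge_rel => ->; rewrite ?orbT.
Qed.

Lemma edge_relE T e : T \subset edges G -> e \in edges G ->
  edge_rel T e.1 e.2 = (e \in T).
Proof.
move=> /fintype.subsetP TG; case: e => u v; rewrite inE /= => /andP[uv _].
rewrite /edge_rel; case: ((v, u) \in T) / idP => [/TG|]; last by rewrite orbF.
by rewrite inE /= ltnNge (ltnW uv).
Qed.

(** If an edge were the parent edge of neither endpoint, parents would still lead every vertex to
    [h] after its removal, so it would not be a bridge. *)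
Lemma tree_parent T h : spanning_tree G T ->
  exists f : 'I_n -> 'I_n,
    (forall x, x != h -> edge_rel T x (f x)) /\
    (forall u v, edge_rel T u v -> u != h /\ f u = v \/ v != h /\ f v = u).
Proof.
move=> [TG Tc Ta]; have [f [d fd]] := parent_map (fun x => Tc x h).
exists f; split=> [x /fd[] //|u v Tuv].
apply: contrapT => /not_orP[fu fv].
have uv : u != v.
  apply/eqP => uv; have := edge_rel_sub TG Tuv.
  by rewrite edge_rel_edges uv adj_irrefl.
pose r' := [rel x y | edge_rel T x y && ((x, y) \notin [:: (u, v); (v, u)])].
have r'sym : symmetric r'.
  move=> x y; rewrite /= edge_rel_sym !inE !xpair_eqE.
  by rewrite [(y == u) && _]andbC [(y == v) && _]andbC orbC.
have r'h x : connect r' x h.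
  have [N] := ubnP (d x); elim: N x => // N IH x dx.
  have [->//|xh] := eqVneq x h; have [rx dfx] := fd _ xh.
  apply: (connect_trans (y := f x)); last first.
    by apply: IH; apply: leq_trans dfx _.
  apply: connect1; rewrite /= rx !inE !xpair_eqE /=.
  apply/negP => /orP[]/andP[/eqP xx /eqP fx]; [apply: fu|apply: fv];
    by rewrite -xx.
have r'c : connect_sym r' by apply: sym_connect_sym.
apply: (acyclic_bridge Ta uv); first by rewrite edge_rel_sym.
by apply: connect_trans (r'h u) _; rewrite r'c.
Qed.

(** Supplies a spanning tree, so that the uniform distribution has a nonzero denominator. *)
Lemma hub_star_tree h : (forall x, x != h -> G x h) ->
  spanning_tree G (edges_at [set h]).
Proof.
move=> Gh; set r := edge_rel (edges_at [set h]).
have rE u v : r u v = G u v && ((u == h) || (v == h)).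
  by rewrite /r edge_rel_at !inE.
have rh x : connect r x h.
  have [->//|xh] := eqVneq x h.
  by apply: connect1; rewrite rE Gh // eqxx orbT.
split.
- by apply/fintype.subsetP => e; rewrite inE => /andP[].
- move=> u v; apply: connect_trans (rh u) _.
  by rewrite (sym_connect_sym (@edge_rel_sym _)).
move=> s s2; rewrite -/r => cs.
have nh x : x \in s -> x = h.
  move=> xs; apply/eqP; apply: contraT => xh.
  have [y [z [_ _ yz]]] := ucycle_nbrs cs s2 xs.
  rewrite !rE (negPf xh) /= orbF => /andP[_ /eqP yh] /andP[_ /eqP zh].
  by rewrite yh zh eqxx in yz.
case: s s2 cs nh => [|x [|y s]] // _ /andP[_ /=]; rewrite inE negb_or.
move=> /andP[/andP[xy _] _] nh.
have xh : x = h by apply: nh; rewrite inE eqxx.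
have yh : y = h by apply: nh; rewrite !inE eqxx orbT.
by rewrite xh yh eqxx in xy.
Qed.

(* A clique attached to the rest of the graph only through the vertex h. *)
Definition hub_block h B : Prop :=
  h \notin B /\ forall x y, x \in B -> G x y = (y != x) && (y \in h |: B).

Section Block.
Variables (h : 'I_n) (B : {set 'I_n}) (c : 'I_n).
Hypotheses (hB : hub_block h B) (cB : c \in B).

(** Under [hub_block], [edges_at B] consists of all edges of the clique on [h |: B]. *)
Definition starify T := (T :\: edges_at B) :|: edges_at [set c].

Lemma star_sub_block : edges_at [set c] \subset edges_at B.
Proof.
apply/fintype.subsetP => e; rewrite !inE => /andP[-> /=].
by move=> /orP[]/eqP->; rewrite cB ?orbT.
Qed.

Lemma edge_rel_starify T u v : T \subset edges G ->
  edge_rel (starify T) u v =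
  [&& edge_rel T u v, u \notin B & v \notin B] ||
  G u v && ((u == c) || (v == c)).
Proof.
move=> /fintype.subsetP TG; rewrite edge_relU edge_rel_at !inE; congr (_ || _).
rewrite /edge_rel !inE /=.
have H x y : (x, y) \in T -> ((x < y)%N && G x y) by move=> /TG; rewrite inE.
apply/idP/idP.
  case/orP=> /andP[+ xyT]; rewrite (H _ _ xyT) /= negb_or => /andP[].
    by rewrite xyT => -> ->.
  by rewrite xyT orbT => -> ->.
by move=> /andP[+ /andP[/negPf-> /negPf->]]; rewrite !andbF.
Qed.

(** Vertices of [B] reach [h] through [c]; a path of T from outside meets [h] before entering [B].
    On a cycle, a vertex of [B] other than [c] would have only [c] as neighbour, and then [c] only
    [h]; so a cycle avoids [B] and already lies in T. *)
Lemma starify_tree T : spanning_tree G T -> spanning_tree G (starify T).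
Proof.
move=> [TG Tc Ta]; have [hnB GB] := hB.
set r := edge_rel (starify T).
have rE u v : r u v = _ := edge_rel_starify u v TG.
have rs : connect_sym r by apply: sym_connect_sym; apply: edge_rel_sym.
have ch : c != h by apply: contraNneq hnB => <-.
have rch : r c h.
  by rewrite rE eqxx andbT (GB c h cB) finset.in_setU1 eqxx andbT eq_sym ch orbT.
have rBh x : x \in B -> connect r x h.
  move=> xB; have [->|xc] := eqVneq x c; first exact: connect1.
  apply: connect_trans (connect1 rch).
  apply: connect1; rewrite rE eqxx orbT andbT; apply/orP; right.
  by rewrite GB // finset.in_setU1 cB orbT andbT eq_sym.
have rh x : connect r x h.
  have /connectP[p] := Tc x h.
  elim: p x => [x _ ->//|y p IH x /=] /andP[xy yp] lasth.
  have [/rBh//|xB] := boolP (x \in B).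
  have [yB|yB] := boolP (y \in B).
    have : G y x by rewrite adj_sym -edge_rel_edges; apply: edge_rel_sub xy.
    by rewrite GB // !inE (negPf xB) orbF => /andP[_ /eqP->].
  apply: connect_trans (IH _ yp lasth); apply: connect1.
  by rewrite rE xy xB yB.
split.
- apply/fintype.subsetP => e; rewrite !inE.
  move=> /orP[/andP[_ /(fintype.subsetP TG)]|/andP[]//].
  by rewrite inE.
- by move=> u v; apply: connect_trans (rh u) _; rewrite rs.
move=> s s2; rewrite -/r => cs.
have nB1 x : x \in s -> x \in B -> x = c.
  move=> xs xB; apply/eqP; apply: contraT => xc.
  have [y [z [_ _ yz]]] := ucycle_nbrs cs s2 xs.
  rewrite !rE xB /= !andbF /= (negPf xc) /= orbF.
  by move=> /andP[_ /eqP yc] /andP[_ /eqP zc]; rewrite yc zc eqxx in yz.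
have nB x : x \in s -> x \notin B.
  move=> xs; apply/negP => xB; have xc := nB1 _ xs xB; subst x.
  have nbh y : y \in s -> G c y -> y = h.
    move=> ys; rewrite GB // !inE => /andP[yc /orP[/eqP//|yB]].
    by rewrite (nB1 y) ?eqxx in yc.
  have [y [z [ys zs yz]]] := ucycle_nbrs cs s2 xs.
  rewrite !rE cB /= !andbF /= => /andP[cy _] /andP[zc _].
  by rewrite (nbh y) // (nbh z) ?eqxx // adj_sym in yz.
apply: (Ta s s2); move: cs => /andP[cs us]; apply/andP; split=> //.
apply: (@sub_in_cycle _ (fun x => x \notin B) r _ _ s) cs.
  move=> x y xB yB; rewrite rE.
  case/orP=> [/and3P[]//|/andP[_ /orP[]/eqP E]].
    by have := negP xB; rewrite E cB.
  by have := negP yB; rewrite E cB.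
by apply/allP.
Qed.

(* Rooting T at h, every edge in the block joins a vertex of B to its parent. *)
Lemma tree_block_code T : spanning_tree G T ->
  exists f : {ffun 'I_n -> 'I_n},
    f \in pffun_on h B (h |: B) /\
    forall e, e \in edges_at B ->
      (e \in T) =
      (e.1 \in B) && (f e.1 == e.2) || (e.2 \in B) && (f e.2 == e.1).
Proof.
move=> Tt; have [hnB GB] := hB; have [TG _ _] := Tt.
have [f [fr fT]] := tree_parent h Tt.
have Bh x : x \in B -> x != h by apply: contraTneq => ->.
(* The default [h] off [B] makes the map an element of [pffun_on], leaving only [#|B|.+1 ^ #|B|]
   possible codes. *)
exists [ffun x => if x \in B then f x else h]; split.
  apply/pffun_onP; split.
    by apply/supportP => x; rewrite ffunE => /negPf->.
  move=> y /mapP[x]; rewrite mem_enum => xB ->; rewrite ffunE xB.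
  have := edge_rel_sub TG (fr _ (Bh _ xB)).
  by rewrite edge_rel_edges GB // => /andP[].
move=> [u v] uv /=; rewrite !ffunE; have eG : (u, v) \in edges G.
  by move: uv; rewrite inE => /andP[].
rewrite -(edge_relE TG eG) /=; apply/idP/idP; last first.
  case/orP=> /andP[xB]; rewrite xB => /eqP<-; first by apply/fr/Bh.
  by rewrite edge_rel_sym; apply/fr/Bh.
move=> Tuv; have Guv : G u v.
  by rewrite -edge_rel_edges; apply: edge_rel_sub Tuv.
have inB x y : G x y -> x != h -> y \in B -> x \in B.
  move=> + xh yB; rewrite adj_sym GB // !inE (negPf xh).
  by move=> /andP[].
move: uv; rewrite inE eG /= => uvB.
have [[uh fu]|[vh fv]] := fT _ _ Tuv.
  have uB : u \in B by case/orP: uvB => // vB; apply: inB vB.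
  by rewrite uB fu eqxx.
have vB : v \in B.
  by case/orP: uvB => // uB; apply: inB uB => //; rewrite adj_sym.
by rewrite vB fv eqxx orbT.
Qed.

(** The map sending T to [starify T] and its parent code is injective: the first component retains T
    outside the clique, the second determines it inside. Stability of [P] keeps the image in the
    family. *)
Lemma starify_count (P : pred {set 'I_n * 'I_n}) :
  (forall T, P T -> P (starify T)) ->
  (#|[set T in spanning_trees G | P T]| <=
   #|[set T in spanning_trees G | P T && (edges_at [set c] \subset T)]|
     * (#|B|.+1 ^ #|B|))%N.
Proof.
move=> PS; set S := [set T in _ | P T]; set S' := [set T in _ | _].
have treeP T : T \in spanning_trees G -> spanning_tree G T.
  by rewrite inE => /asboolP.
have /choice[F FP] T : exists f : {ffun 'I_n -> 'I_n}, spanning_tree G T ->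
    f \in pffun_on h B (h |: B) /\
    forall e, e \in edges_at B ->
      (e \in T) =
      (e.1 \in B) && (f e.1 == e.2) || (e.2 \in B) && (f e.2 == e.1).
  have [Tt|nT] := pselect (spanning_tree G T); last by exists [ffun=> h].
  by have [f fP] := tree_block_code Tt; exists f.
pose C := [set f in pffun_on h B (h |: B)].
have cC : #|C| = (#|B|.+1 ^ #|B|)%N.
  by rewrite cardsE card_pffun_on cardsU1 (proj1 hB).
rewrite -cC -cardsX.
rewrite -(card_in_imset (f := fun T => (starify T, F T)) (D := mem S)).
  apply: subset_leq_card; apply/fintype.subsetP => _ /imsetP[T TS ->].
  have /andP[/treeP Tt PT] : (T \in spanning_trees G) && P T.
    by rewrite finset.in_set in TS.
  rewrite finset.in_setX !finset.in_set (proj1 (FP _ Tt)) PS //.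
  by rewrite finset.subsetUr !andbT; apply/asboolP; apply: starify_tree.
move=> T1 T2; rewrite !inE => /andP[/asboolP t1 _] /andP[/asboolP t2 _] [E1 E2].
apply/finset.setP => e; have [eB|eB] := boolP (e \in edges_at B).
  by rewrite (proj2 (FP _ t1)) // (proj2 (FP _ t2)) // E2.
have eS T : (e \in starify T) = (e \in T).
  rewrite finset.in_setU finset.in_setD eB /=; apply: orb_idr.
  by move=> /(fintype.subsetP star_sub_block); rewrite (negPf eB).
by rewrite -eS E1 eS.
Qed.

End Block.
End Graph.

(** * Laplacians, leverage scores and the cut of one vertex *)

Section Laplacian.
Variables (R : realType) (n : nat) (G : sgraph n).
Implicit Types (x y : 'cV[R]_n) (e : 'I_n * 'I_n) (S : {set 'I_n * 'I_n}).

Lemma edge_vec_mul e x : (edge_vec R e)^T *m x = (x e.1 0 - x e.2 0)%:M.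
Proof.
apply/matrixP => i j.
by rewrite !ord1 linearB /= !trmx_delta mulmxBl -!rowE !mxE eqxx.
Qed.

Lemma laplacian_mulE (w : 'I_n * 'I_n -> R) S x :
  laplacian w S *m x =
  \sum_(e in S) (w e * (x e.1 0 - x e.2 0)) *: edge_vec R e.
Proof.
rewrite mulmx_suml; apply: eq_bigr => e _.
by rewrite -scalemxAl -mulmxA edge_vec_mul mul_mx_scalar scalerA.
Qed.

Lemma laplacian_sym (w : 'I_n * 'I_n -> R) S :
  (laplacian w S)^T = laplacian w S.
Proof.
rewrite linear_sum; apply: eq_bigr => e _.
by rewrite linearZ /= trmx_mul trmxK.
Qed.

Lemma qform_laplacian (w : 'I_n * 'I_n -> R) S x :
  qform (laplacian w S) x = \sum_(e in S) w e * (x e.1 0 - x e.2 0) ^+ 2.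
Proof.
rewrite /qform -mulmxA laplacian_mulE mulmx_sumr summxE; apply: eq_bigr => e _.
rewrite -scalemxAr -[x^T *m _]trmxK trmx_mul trmxK edge_vec_mul.
by rewrite tr_scalar_mx !mxE eqxx -mulrA expr2.
Qed.

Lemma graph_laplacian_mulE x i :
  (graph_laplacian R G *m x) i 0 = \sum_(j | G i j) (x i 0 - x j 0).
Proof.
rewrite laplacian_mulE summxE.
under eq_bigr => e _ do rewrite mul1r !mxE eqxx !andbT mulrBr.
rewrite sumrB; under [X in X - _]eq_bigl do rewrite inE.
under [X in _ - X]eq_bigl do rewrite inE.
rewrite -(pair_big_dep xpredT (fun u v : 'I_n => (u < v)%N && G u v)
  (fun u v => (x u 0 - x v 0) * (i == u)%:R)) /=.
rewrite -(pair_big_dep xpredT (fun u v : 'I_n => (u < v)%N && G u v)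
  (fun u v => (x u 0 - x v 0) * (i == v)%:R)) /=.
rewrite (bigD1 i) //= [X in _ + X - _]big1 ?addr0; last first.
  by move=> u ui; rewrite big1 // => v _; rewrite eq_sym (negPf ui) mulr0.
have -> : \sum_(u < n) \sum_(v < n | (u < v)%N && G u v)
      (x u 0 - x v 0) * (i == v)%:R =
    \sum_(u < n | (u < i)%N && G u i) (x u 0 - x i 0).
  rewrite [RHS]big_mkcond; apply: eq_bigr => u _.
  rewrite big_mkcond (bigD1 i) //= eqxx mulr1 big1 ?addr0 //.
  by move=> v vi; rewrite eq_sym (negPf vi) mulr0 if_same.
(* Each edge is stored once: neighbours above [i] come from the first endpoints, those below from
   the second. *)
rewrite -sumrN [RHS](bigID (fun j : 'I_n => (i < j)%N)) /=; congr (_ + _).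
  by apply: eq_big => [j|j _]; rewrite ?eqxx ?mulr1 // andbC.
apply: eq_big => [j|j _]; last by rewrite opprB.
rewrite [G j i]adj_sym -leqNgt andbC; case: ltngtP => //= /val_inj ->.
by rewrite adj_irrefl.
Qed.

(** With L y = b and X the pseudoinverse, b^T X b = y^T L X L y = y^T L y = y^T b. Any potential
    thus gives the leverage, without computing X. *)
Lemma leverage_potential e y :
  graph_laplacian R G *m y = edge_vec R e ->
  leverage R G e = y e.1 0 - y e.2 0.
Proof.
move=> Ly; rewrite /leverage /qform -Ly trmx_mul laplacian_sym.
have [LXL _ _ _] := pinvP (graph_laplacian R G).
rewrite mulmxA -!(mulmxA y^T) LXL Ly.
rewrite -[y^T *m _]trmxK trmx_mul trmxK edge_vec_mul.
by rewrite tr_scalar_mx !mxE eqxx.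
Qed.

Lemma edge_vec_swap u v : edge_vec R (v, u) = - edge_vec R (u, v) :> 'cV_n.
Proof. by rewrite /edge_vec opprB. Qed.

Section Block.
Variables (h : 'I_n) (B : {set 'I_n}) (c : 'I_n).
Hypotheses (hB : hub_block G h B) (cB : c \in B).
Let m : R := #|B|.+1%:R.

(** On potentials vanishing outside [B], in particular at the hub, the Laplacian acts as m I - J,
    that of the complete graph on [h |: B]. *)
Lemma block_laplacian_mulE y : (forall i, i \notin B -> y i 0 = 0) ->
  graph_laplacian R G *m y =
  \col_i ((i \in B)%:R * m * y i 0 - (i \in h |: B)%:R * \sum_(j in B) y j 0).
Proof.
move=> yB; have [hnB GB] := hB.
apply/colP => i; rewrite graph_laplacian_mulE mxE.
have yh : y h 0 = 0 by apply: yB.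
rewrite finset.in_setU1; have [iB|iB] /= := boolP (i \in B).
  rewrite orbT !mul1r.
  transitivity (\sum_(j in h |: B) (y i 0 - y j 0)).
    rewrite (eq_bigl _ _ (GB i ^~ iB)).
    rewrite [RHS](bigD1 i) /= ?subrr ?add0r ?finset.in_setU1 ?iB ?orbT //.
    by apply: eq_bigl => j; rewrite andbC.
  rewrite sumrB sumr_const cardsU1 hnB add1n -mulr_natl big_setU1 //= yh add0r.
  by [].
rewrite !mul0r sub0r orbF; have [->|ih] := eqVneq i h.
  rewrite mul1r -sumrN yh big_mkcond [RHS]big_mkcond; apply: eq_bigr => j _.
  have [jB|jB] := boolP (j \in B); last by rewrite (yB j) // subr0 if_same.
  by rewrite adj_sym GB // eq_sym (memPn hnB) // setU11 sub0r.
rewrite mul0r oppr0 big1 // => j ij; rewrite (yB i) // (yB j) ?subr0 //.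
apply: contraL ij => jB.
by rewrite adj_sym GB // finset.in_setU1 (negPf ih) (negPf iB) andbF.
Qed.

Lemma block_potential u : u != c -> u \in h |: B ->
  exists y : 'cV[R]_n, graph_laplacian R G *m y = edge_vec R (c, u) /\
    y c 0 - y u 0 = 2 / m.
Proof.
move=> uc; have [hnB GB] := hB; have m0 : m != 0 by rewrite pnatr_eq0.
have ch : c != h by apply: contraNneq hnB => <-.
have sc (a : 'I_n) : a \in B -> \sum_(j in B) (j == a)%:R = 1 :> R.
  move=> aB; rewrite (bigD1 a) //= eqxx big1 ?addr0 // => j /andP[_ ja].
  by rewrite (negPf ja).
rewrite finset.in_setU1 => /orP[/eqP uh|uB].
  (* The clique potential (1_c - 1_h)/m, shifted by 1/m on the clique so that it vanishes at [h]. *)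
  exists (\col_i (((i == c)%:R + (i \in B)%:R) / m)).
  rewrite !mxE uh eqxx cB (negPf hnB) [h == c]eq_sym (negPf ch) /=.
  split; last by field.
  rewrite block_laplacian_mulE; last first.
    move=> i iB; rewrite mxE (negPf iB).
    by case: eqP iB => [->|_]; rewrite ?cB // addr0 mul0r.
  apply/colP => i; rewrite !mxE eqxx !andbT.
  have -> : \sum_(j in B)
      (\col_k (((k == c)%:R + (k \in B)%:R) / m) : 'cV_n) j 0 = 1.
    under eq_bigr => j jB do rewrite mxE jB.
    by rewrite -mulr_suml big_split /= sc // sumr_const nat1r divff.
  rewrite finset.in_setU1; have [->|ih] := eqVneq i h.
    by rewrite (negPf hnB) /= [h == c]eq_sym (negPf ch) /=; ring.
  rewrite /=; have [->|ic] := eqVneq i c; first by rewrite cB /=; field.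
  by case: (i \in B); rewrite /=; field.
exists (\col_i (((i == c)%:R - (i == u)%:R) / m)).
rewrite !mxE !eqxx (negPf uc) [c == u]eq_sym (negPf uc) /=.
split; last by field.
rewrite block_laplacian_mulE; last first.
  move=> i iB; rewrite mxE; case: eqP iB => [->|_]; rewrite ?cB //.
  by case: eqP => [->|_]; rewrite ?uB // subr0 mul0r.
apply/colP => i; rewrite !mxE eqxx !andbT.
have -> : \sum_(j in B)
    (\col_k (((k == c)%:R - (k == u)%:R) / m) : 'cV_n) j 0 = 0.
  under eq_bigr => j jB do rewrite mxE.
  by rewrite -mulr_suml sumrB !sc // subrr mul0r.
rewrite mulr0 subr0.
have [iB|iB] := boolP (i \in B); first by rewrite /=; field.
have [ic|_] := eqVneq i c; first by rewrite ic cB in iB.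
have [iu|_] := eqVneq i u; first by rewrite iu uB in iB.
by rewrite mul0r mul0r subr0.
Qed.

Lemma star_leverage e : e \in edges_at G [set c] -> leverage R G e = 2 / m.
Proof.
case: e => u v; rewrite !inE /= => /andP[/andP[_ Guv]] /orP[]/eqP E.
  move: Guv; rewrite E (proj2 hB) // => /andP[vc vB].
  have [y [Ly <-]] := block_potential vc vB.
  exact: leverage_potential Ly.
move: Guv; rewrite E adj_sym (proj2 hB) // => /andP[uc uB].
have [y [Ly <-]] := block_potential uc uB.
rewrite (@leverage_potential _ (- y)) /= ?mxE ?opprK 1?addrC //.
by rewrite mulmxN Ly edge_vec_swap.
Qed.

Lemma star_not_lap_lt S (a : R) :
  S \subset edges G -> edges_at G [set c] \subset S ->
  a <= m / 2 ->
  ~ lap_lt (inv_leverage_laplacian R G S) (a *: graph_laplacian R G).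
Proof.
move=> SG cS am; have [hnB GB] := hB.
have ch : c != h by apply: contraNneq hnB => <-.
have n0 : n%:R != 0 :> R.
  by rewrite pnatr_eq0 -lt0n; apply: leq_ltn_trans (ltn_ord h).
(* The indicator of [c], centred to be orthogonal to the ones vector. The shift is invisible to
   Laplacians, so both forms reduce to sums of weights over the edges at [c]: m/2 each against [a]
   each. *)
pose x : 'cV[R]_n := \col_i ((i == c)%:R - n%:R^-1).
have qx w (F : {set 'I_n * 'I_n}) :
    F \subset edges G -> edges_at G [set c] \subset F ->
    qform (laplacian w F) x = \sum_(e in edges_at G [set c]) w e.
  move=> /fintype.subsetP FG /fintype.subsetP cF.
  rewrite qform_laplacian big_mkcond [RHS]big_mkcond.
  apply: eq_bigr => -[u v] _.
  case: ifPn => [/[dup] /FG eG uvF|/(contraNN (cF _)) /negPf->//].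
  rewrite [_ \in edges_at _ _]inE eG !mxE /= !inE.
  move: eG; rewrite inE /= => /andP[uv _].
  have uv' : u != v by apply: contraTneq uv => ->; rewrite ltnn.
  have [uc|uc] := eqVneq u c.
    have -> : (v == c) = false by rewrite -uc eq_sym (negPf uv').
    by rewrite /=; ring.
  by case: eqVneq => /= _; ring.
have x0 : x != 0.
  apply/eqP => /matrixP/(_ h 0); rewrite !mxE eq_sym (negPf ch) sub0r => /eqP.
  by rewrite oppr_eq0 invr_eq0 (negPf n0).
have sx : \sum_i x i 0 = 0.
  under eq_bigr do rewrite mxE.
  rewrite sumrB sumr_const card_ord -[_ *+ n]mulr_natl divff //.
  rewrite (bigD1 c) //= eqxx big1 ?addr0 ?subrr // => j /negPf->//.
move=> lt; have := lt x x0 sx; apply/negP; rewrite -leNgt.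
have -> : qform (a *: graph_laplacian R G) x =
    a * qform (graph_laplacian R G) x.
  by rewrite /qform -scalemxAr -scalemxAl mxE.
have cG : edges_at G [set c] \subset edges G by apply: fintype.subset_trans SG.
rewrite !qx // mulr_sumr; apply: ler_sum => e /star_leverage->.
by rewrite mulr1 invf_div.
Qed.

End Block.
End Laplacian.

(** * Counting the trees that miss every star *)

(** Edges leaving [B] end at [h], so a vertex outside [h |: B] has no neighbour in [B]; changing one
    clique leaves the stars of the others alone. *)
Lemma star_notin_block n (G : sgraph n) (h : 'I_n) (B : {set 'I_n}) x e :
  hub_block G h B -> x != h -> x \notin B ->
  e \in edges_at G [set x] -> e \notin edges_at G B.
Proof.
move=> [_ GB] xh xB; rewrite !inE; case: e => u v /= /andP[/andP[-> Guv]].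
have nb y : G x y -> y \notin B.
  move=> Gxy; apply: contraL Gxy => yB.
  by rewrite adj_sym GB // finset.in_setU1 (negPf xh) (negPf xB) andbF.
rewrite Guv /= negb_or => /orP[]/eqP E; move: Guv; rewrite E.
  by move=> /nb ->; rewrite xB.
by rewrite adj_sym => /nb ->.
Qed.

Lemma no_star_count (R : realType) n (G : sgraph n) (h : 'I_n) (b k : nat)
    (B : nat -> {set 'I_n}) (c : nat -> 'I_n) :
  (forall j, (j < k)%N ->
     [/\ hub_block G h (B j), c j \in B j & #|B j| = b]) ->
  (forall i j, (i < j < k)%N -> c i \notin B j) ->
  #|[set T in spanning_trees G |
      all (fun j => ~~ (edges_at G [set c j] \subset T)) (iota 0 k)]|%:R <=
  (1 - (b.+1 ^ b)%:R^-1) ^+ k * #|spanning_trees G|%:R :> R.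
Proof.
set P := fun k (T : {set 'I_n * 'I_n}) =>
  all (fun j => ~~ (edges_at G [set c j] \subset T)) (iota 0 k).
have Mgt0 : 0 < (b.+1 ^ b)%:R :> R by rewrite ltr0n expn_gt0.
have Minv : (b.+1 ^ b)%:R^-1 <= 1 :> R by rewrite invf_le1 // ler1n expn_gt0.
elim: k => [|k IH] Bk cB.
  rewrite expr0 mul1r ler_nat.
  apply: subset_leq_card; apply/fintype.subsetP => T.
  by rewrite finset.in_set => /andP[].
have {}IH : #|[set T in spanning_trees G | P k T]|%:R <=
    (1 - (b.+1 ^ b)%:R^-1) ^+ k * #|spanning_trees G|%:R :> R.
  apply: IH => [j jk|i j /andP[ij jk]]; first exact/Bk/ltnW.
  by apply: cB; rewrite ij ltnW.
have [hBk cBk bBk] := Bk k (ltnSn k).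
(* Starring clique [k] adds only edges of [edges_at G (B k)], none of which belongs to an earlier
   star. *)
have PS T : P k T -> P k (starify G (B k) (c k) T).
  move=> /allP PT; apply/allP => i ik; have := PT i ik.
  move: ik; rewrite mem_iota add0n => /= ik.
  have [hBi cBi _] := Bk i (ltnW ik).
  apply: contraNN => /fintype.subsetP sub; apply/fintype.subsetP => e ei.
  have := sub e ei; rewrite finset.in_setU finset.in_setD.
  have eB : e \notin edges_at G (B k).
    apply: star_notin_block hBk _ _ ei; last by apply: cB; rewrite ik ltnSn.
    by apply: contraNneq (proj1 hBi) => <-.
  rewrite eB /= => /orP[//|/(fintype.subsetP (star_sub_block G cBk))].
  by rewrite (negPf eB).
have := starify_count hBk cBk PS; rewrite bBk.
set S := [set T in _ | P k T]; set S' := [set T in _ | _ && _].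
move=> countS.
(* Trees missing the first [k] stars split according to whether they contain the next one. *)
have cardS :
    #|S| = (#|S'| + #|[set T in spanning_trees G | P k.+1 T]|)%N.
  rewrite -(cardsID S' S); congr (_ + _)%N; apply: eq_card => T.
    by rewrite !inE; case: `[< _ >] => //=; rewrite andbA andbb.
  rewrite !inE /P -addn1 iotaD all_cat /= andbT add0n.
  by case: (asbool _) => //=; case: (all _ _); rewrite //= andbT.
have : #|S|%:R * (b.+1 ^ b)%:R^-1 <= #|S'|%:R :> R.
  by rewrite ler_pdivrMr // -natrM ler_nat.
rewrite exprS -mulrA => SS'.
apply: le_trans (ler_wpM2l _ IH); last by rewrite subr_ge0.
by rewrite -/S cardS natrD in SS' *; rewrite mulrBl mul1r [_^-1 * _]mulrC; lra.
Qed.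

(** * The windmill graph *)

(** Vertex 0 is the hub and a vertex u > 0 lies in blade (u-1)/b. Leftover vertices form a smaller
    last blade, so any number of vertices is allowed. *)
Definition windmill_rel n b : rel 'I_n := fun u v =>
  (u != v) && [|| val u == 0%N, val v == 0%N | u.-1 %/ b == v.-1 %/ b]%N.

Lemma windmill_sym n b : symmetric (@windmill_rel n b).
Proof.
move=> u v; rewrite /windmill_rel eq_sym; congr (_ && _).
by rewrite orbCA [in RHS]orbCA orbCA [(_ %/ _ == _)%N]eq_sym.
Qed.

Lemma windmill_irrefl n b : irreflexive (@windmill_rel n b).
Proof. by move=> u; rewrite /windmill_rel eqxx. Qed.

Definition windmill n b := SGraph (@windmill_sym n b) (@windmill_irrefl n b).

Definition blade n b j : {set 'I_n} :=
  [set u : 'I_n | (val u != 0%N) && (u.-1 %/ b == j)%N].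

Lemma card_blade n b j : (0 < b)%N -> (j < n %/ b)%N -> #|blade n.+1 b j| = b.
Proof.
move=> b0 jn; have jb : (j.+1 * b <= n)%N.
  by apply: leq_trans (leq_trunc_div n b); rewrite leq_mul2r jn orbT.
have ltn (i : 'I_b) : ((j * b + i).+1 < n.+1)%N.
  by rewrite ltnS; apply: leq_trans jb; rewrite mulSn addnC ltn_add2r.
have -> : blade n.+1 b j = (fun i : 'I_b => Ordinal (ltn i)) @: [set: 'I_b]%SET.
  apply/finset.setP => u; rewrite inE.
  apply/andP/imsetP => [[u0 /eqP uj]|[i _ ->]].
    have ub : (u.-1 %% b < b)%N by rewrite ltn_mod.
    exists (Ordinal ub) => //; apply: ord_inj => /=.
    by rewrite -uj -divn_eq prednK // lt0n.
  by rewrite /= divnMDl // divn_small // addn0 eqxx.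
rewrite card_imset ?finset.cardsT ?card_ord // => i i' /(congr1 val) /= [] /addnI.
exact: val_inj.
Qed.

Lemma windmill_hub n b (x : 'I_n.+1) : x != ord0 -> windmill n.+1 b x ord0.
Proof. by move=> x0; rewrite /= /windmill_rel x0 /= orbT. Qed.

Lemma windmill_connected n b : rel_connected (windmill n.+1 b).
Proof.
have h x : connect (windmill n.+1 b) x ord0.
  have [->//|x0] := eqVneq x ord0; exact/connect1/windmill_hub.
move=> u v; apply: connect_trans (h u) _.
by rewrite (sym_connect_sym (@windmill_sym _ _)).
Qed.

Lemma blade_hub_block n b j : hub_block (windmill n.+1 b) ord0 (blade n.+1 b j).
Proof.
split=> [|x y]; first by rewrite inE.
rewrite inE => /andP[x0 /eqP xj].
rewrite /= /windmill_rel (negPf x0) /= [x == y]eq_sym xj !inE [j == _]eq_sym.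
by congr (_ && _); rewrite -[y == ord0]val_eqE; case: (val y == _).
Qed.

(** * Choice of the blade size *)

Section Numerics.
Variable R : realType.

Lemma log2_ge64 (n : nat) : 2 ^+ 64 <= n%:R :> R -> 64 <= log2 (n%:R : R).
Proof.
move=> hn; have l2 : 0 < ln 2 :> R by rewrite ln_gt0 // ltr1n.
rewrite /log2 ler_pdivlMr // mulr_natl -lnXn // ler_ln ?posrE ?exprn_gt0 //.
by apply: lt_le_trans hn; rewrite exprn_gt0.
Qed.

(** By concavity, [ln] lies below its tangent at [s]. Taken at 2 it gives ln 2 >= 1/2; at 64 it
    turns the estimates below into linear ones. *)
Lemma ln_le_tangent (t s : R) : 0 < t -> 0 < s -> ln t <= ln s + (t / s - 1).
Proof.
move=> t0 s0; have ts : 0 < t / s by rewrite divr_gt0.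
have -> : ln t = ln s + ln (t / s) by rewrite ln_div ?posrE // addrC subrK.
rewrite lerD2l -[in leLHS](subrK 1 (t / s)) addrC.
by rewrite le_ln1Dx // -subr_gt0 opprK subrK.
Qed.

Lemma blade_size (n : nat) : 2 ^+ 64 <= n%:R :> R ->
  exists b : nat, [/\ (0 < b)%N,
    log2 n%:R / (8 * log2 (log2 n%:R)) <= b.+1%:R / 2 :> R &
    n%:R `^ (4 / 10) <= (n.-1 %/ b)%:R / (b.+1 ^ b)%:R :> R].
Proof.
move=> hn; have l64 := log2_ge64 hn; set l := log2 _ in l64 *.
have ln2_gt0 : 0 < ln 2 :> R by rewrite ln_gt0 // ltr1n.
have ln2_ge : 2^-1 <= ln 2 :> R.
  have := @ln_le_tangent 1 2 ltr01 (ltr0n _ _); rewrite ln1; lra.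
have ln64 : 6 * ln 2 = ln 64 :> R.
  by rewrite mulr_natl -lnXn //; congr ln; ring.
have lnl_ge : 6 * ln 2 <= ln l.
  by rewrite ln64 ler_ln ?posrE //; lra.
have lnl_le : ln l <= 6 * ln 2 + (l / 64 - 1).
  by rewrite ln64; apply: ln_le_tangent; lra.
have lnl_gt0 : 0 < ln l by lra.
have n0 : 0 < n%:R :> R by apply: lt_le_trans hn; rewrite exprn_gt0.
have lnE : ln n%:R = l * ln 2 by rewrite /l /log2 divfK // gt_eqF.
(* This is log n / (4 log log n), twice the required factor, so that a ln l = (ln n)/4. *)
pose a := l * ln 2 / (4 * ln l).
have a0 : 0 <= a by rewrite divr_ge0 // mulr_ge0 //; [lra | exact: ltW | lra].
have aE : a * ln l = l * ln 2 / 4 by rewrite /a; field; rewrite gt_eqF.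
pose b := (Num.truncn a).+1; exists b.
have /andP[ba ab] := truncn_itv a0.
have ale : a <= l / 24.
  rewrite /a ler_pdivrMr; last lra.
  have : l * (6 * ln 2) <= l * ln l by rewrite ler_pM2l //; lra.
  lra.
split=> //.
  have -> : l / (8 * log2 l) = a / 2.
    by rewrite /log2 /a; field; rewrite !gt_eqF.
  rewrite ler_pM2r ?invr_gt0 // (le_trans (ltW ab)) // ler_nat.
  by rewrite /b.
have bS : b.+1%:R <= a + 2 by rewrite /b -!natr1; lra.
have bl : b.+1%:R <= l by lra.
have lnb : ln b.+1%:R <= ln l by rewrite ler_ln ?posrE ?ltr0n //; lra.
have lnb0 : 0 <= ln b.+1%:R :> R by rewrite ln_ge0 // ler1n.
(* Since b+1 <= a+2 and b+1 <= l, the logarithm is at most (ln n)/4 + 2 ln l. The exponent [b.+1],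
   one more than in [M], leaves room for the rounding in the number of blades. *)
have main : (b.+1 ^ b.+1)%:R <= n%:R `^ (6 / 10) :> R.
  rewrite -ler_ln ?posrE ?ltr0n ?expn_gt0 ?powR_gt0 //.
  rewrite ln_powR lnE natrX lnXn ?ltr0n //.
  rewrite -(mulr_natl (ln _)).
  have : b.+1%:R * ln b.+1%:R <= (a + 2) * ln l by rewrite ler_pM.
  rewrite [(a + 2) * _]mulrDl aE => /le_trans; apply.
  have : 64 * ln 2 <= l * ln 2 by rewrite ler_pM2r.
  have : l * 2^-1 <= l * ln 2 by rewrite ler_pM2l //; lra.
  lra.
set p := n%:R `^ (4 / 10).
have p1 : 1 <= p.
  by rewrite -(powRr0 n%:R) ler_powR ?divr_ge0 // ler1n -(ltr0n R).
have np : n%:R `^ (6 / 10) * p = n%:R.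
  rewrite -powRD; last by rewrite (gt_eqF n0) implybT.
  have -> : 6 / 10 + 4 / 10 = 1 :> R by field.
  by rewrite powRr1 // ltW.
set M := (b.+1 ^ b)%:R.
have M0 : 0 < M by rewrite ltr0n expn_gt0.
have bM : b%:R <= M by rewrite ler_nat ltnW // ltn_expl.
have b0 : 0 < b%:R :> R by rewrite ltr0n.
have kb : n%:R <= (n.-1 %/ b)%:R * b%:R + b%:R :> R.
  rewrite -natrM -natrD ler_nat.
  by case: (n) => // n'; rewrite addnC -mulSn ltn_ceil.
(* The spare term [M * p] absorbs the [b] lost to floor division in [kb]. *)
have bMp : b%:R * M * p + M * p <= n%:R.
  rewrite -np -mulrDl ler_pM2r; last exact: lt_le_trans p1.
  by move: main; rewrite expnS natrM -/M -natr1 mulrDl mul1r.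
rewrite ler_pdivlMr // -(ler_pM2r b0) -mulrA mulrC [M * _]mulrC.
rewrite -(lerD2r b%:R) (le_trans _ kb) // (le_trans _ bMp) // lerD2l.
by rewrite (le_trans bM) // ler_peMr // ltW.
Qed.

End Numerics.

(** * The probability bound for the windmill *)

Theorem theorem1p6 (R : realType) (n : nat) (hn : (2 ^ (2 ^ 6) <= n)%N) :
  exists G : sgraph n,
    rel_connected G /\
    1 - expR (- (n%:R `^ (4 / 10))) <=
      ust_prob R G (fun T =>
        ~ lap_lt (inv_leverage_laplacian R G T)
            ((log2 n%:R / (8 * log2 (log2 n%:R))) *: graph_laplacian R G)).
Proof.
have {hn} : 2 ^+ 64 <= n%:R :> R.
  by move: hn; rewrite -(ler_nat R) natrX.
case: n => [|n] hn.
  by have := lt_le_trans (exprn_gt0 64 (ltr0n R 2)) hn; rewrite ltxx.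
have [b [b0 ratio size]] := blade_size hn.
set a := _ / (8 * _) in ratio *; pose G := windmill n.+1 b.
exists G; split; first exact: windmill_connected.
set k := (n.+1.-1 %/ b)%N in size; set M := (b.+1 ^ b)%:R in size.
clearbody a; clear hn.
(* The first vertex of blade [j]. *)
pose c j : 'I_n.+1 := inord (j * b).+1.
have cE j : (j < k)%N -> c j = (j * b).+1 :> nat.
  move=> jk; rewrite /c /= inordK // !ltnS.
  by apply: leq_trans (leq_trunc_div n b); rewrite ltn_mul2r b0.
have cB i j : (i < k)%N -> (c i \in blade n.+1 b j) = (i == j).
  by move=> ik; rewrite inE /= cE //= mulnK.
have blades j : (j < k)%N -> [/\ hub_block G ord0 (blade n.+1 b j),
    c j \in blade n.+1 b j & #|blade n.+1 b j| = b].
  by move=> jk; rewrite cB // card_blade //; split=> //; apply: blade_hub_block.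
have disj i j : (i < j < k)%N -> c i \notin blade n.+1 b j.
  by move=> /andP[ij jk]; rewrite cB ?(ltn_trans ij) // ltn_eqF.
have := @no_star_count R _ G ord0 b k (blade n.+1 b) c blades disj.
rewrite -/M => count.
set N := #|spanning_trees G| in count.
have N0 : 0 < N%:R :> R.
  rewrite ltr0n; apply/card_gt0P; exists (edges_at G [set ord0]); rewrite inE.
  by apply/asboolP; apply: hub_star_tree; apply: windmill_hub.
rewrite /ust_prob -/N ler_pdivlMr //.
set bad := [set T in _ | all _ _] in count; set good := [set T in _ | _].
(* A tree that is not bad contains some star, and that star alone forces the event. *)
have cover : (N <= #|good| + #|bad|)%N.
  apply: leq_trans (leq_card_setU _ _); apply: subset_leq_card.
  apply/fintype.subsetP => T Ttree; rewrite finset.in_setU.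
  rewrite [_ \in good]finset.in_set [_ \in bad]finset.in_set.
  rewrite Ttree /= orbC; case: allP => //= /existsNP[j /not_implyP[]].
  rewrite mem_iota add0n => /= jk /negP; rewrite negbK => sub.
  have [hBj cBj bBj] := blades j jk.
  have TG : T \subset edges G by move: Ttree; rewrite inE => /asboolP[].
  apply/asboolP; have := star_not_lap_lt hBj cBj TG sub.
  by apply; rewrite bBj.
(* From 1 - t <= e^(-t) at t = 1/M, together with k/M >= n^0.4. *)
have decay : (1 - M^-1) ^+ k <= expR (- (n.+1%:R `^ (4 / 10))).
  have M0 : 0 < M by rewrite ltr0n expn_gt0.
  have M1 : M^-1 <= 1 by rewrite invf_le1 // ler1n expn_gt0.
  apply: (@le_trans _ _ (expR (- M^-1) ^+ k)).
    by rewrite lerXn2r ?nnegrE ?expR_ge0 ?expR_ge1Dx // subr_ge0.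
  by rewrite -expRM_natl ler_expR mulrN lerN2.
rewrite mulrBl mul1r lerBlDr.
have : N%:R <= #|good|%:R + #|bad|%:R :> R by rewrite -natrD ler_nat.
move=> /le_trans; apply; rewrite lerD2l (le_trans count) //.
by rewrite ler_wpM2r // ltW.
Qed.
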